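(* Let $R$ be a route and let $S\subseteq V_C=\{1,\dots,n\}$ be the set of customers visited on $R$. For each of the five uncertainty sets $\mathcal{Q}\in\{\mathcal{Q}_B,\mathcal{Q}_F,\mathcal{Q}_E,\mathcal{Q}_G,\mathcal{Q}_D\}$ defined in the context, the worst-case load $\max_{q\in\mathcal{Q}}\sum_{i\in S}q_i$ is given as follows. 1. (Budget set) $$\max_{q\in\mathcal{Q}_B}\sum_{i\in S}q_i=\sum_{i\in S}\bar q_i-\sum_{l=1}^{L}\max\Big\{0,\ \sum_{i\in S\cap B_l}(\bar q_i-\underline q_i)-\Big(b_l-\sum_{i\in B_l}\underline q_i\Big)\Big\}.$$ 2. (Factor model) $$\max_{q\in\mathcal{Q}_F}\sum_{i\in S}q_i=\sum_{i\in S}q^0_i+\min\Big\{\sum_{f=1}^{F}\Big|\sum_{i\in S}\Psi_{if}-\lambda\Big|+\beta F|\lambda|\ :\ \lambda\in\Big\{0,\ \sum_{i\in S}\Psi_{if_{\ell^+}},\ \sum_{i\in S}\Psi_{if_{\ell^-}}\Big\}\Big\},$$ where $f_1,\dots,f_F$ is an ordering of the factors $1,\dots,F$ such that $\sum_{i\in S}\Psi_{if_1}\ge\dots\ge\sum_{i\in S}\Psi_{if_F}$, and $\ell^+=\lceil(1+\beta)F/2\rceil$, $\ell^-=\max\{1,\lceil(1-\beta)F/2\rceil\}$. 3. (Ellipsoid) $$\max_{q\in\mathcal{Q}_E}\sum_{i\in S}q_i=\sum_{i\in S}q^0_i+\Big\|\sum_{i\in S}\Sigma^{1/2}_i\Big\|_2,$$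 where $\Sigma^{1/2}_i$ is the $i$-th column of $\Sigma^{1/2}$ and $\|\cdot\|_2$ is the $\ell_2$-norm. 4. (Cardinality-constrained set) $$\max_{q\in\mathcal{Q}_G}\sum_{i\in S}q_i=\sum_{i\in S}q^0_i+\sum_{\ell=1}^{\min\{|S|,\lfloor\Gamma\rfloor\}}\hat q_{g_\ell}+\lambda,$$ where $g_1,\dots,g_{|S|}$ is an ordering of the customers in $S$ such that $\hat q_{g_1}\ge\dots\ge\hat q_{g_{|S|}}$, and $\lambda=(\Gamma-\lfloor\Gamma\rfloor)\,\hat q_{g_{\lfloor\Gamma\rfloor+1}}$ if $|S|\ge\lfloor\Gamma\rfloor+1$ and $\lambda=0$ otherwise. 5. (Discrete set) $$\max_{q\in\mathcal{Q}_D}\sum_{i\in S}q_i=\max\Big\{\sum_{i\in S}q^{(d)}_i:\ d\in\{1,\dots,D\}\Big\}.$$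
   Context: There are $n$ customers $V_C=\{1,\dots,n\}$ with uncertain demand vector $q\in\mathbb{R}^n$; a route visits a finite set $S\subseteq V_C$ of distinct customers, and its worst-case load over an uncertainty set $\mathcal{Q}$ is $\max_{q\in\mathcal{Q}}\sum_{i\in S}q_i$. Uncertainty sets are assumed to be non-empty, closed and bounded subsets of $\mathbb{R}^n_+$. Budget set: $\mathcal{Q}_B=\{q\in[\underline q,\bar q]:\sum_{i\in B_l}q_i\le b_l\ \ \forall l\in\{1,\dots,L\}\}$, where $L\in\mathbb{N}$, $\underline q\le\bar q$ are vectors in $\mathbb{R}^n$ (and $[\underline q,\bar q]$ is the corresponding hyperrectangle), $B_l\subseteq V_C$ and $b_l\in\mathbb{R}_+$ with $\sum_{i\in B_l}\underline q_i\le b_l$ for all $l$, and the sets $B_1,\dots,B_L$ are pairwise disjoint. Factor model: $\mathcal{Q}_F=\{q\in\mathbb{R}^n: q=q^0+\Psi\xi\text{ for some }\xi\in\Xi_F\}$ with $\Xi_F=\{\xi\in[-1,1]^F:|e^\top\xi|\le\beta F\}$, where $q^0\in\mathbb{R}^n_+$, $F\in\mathbb{N}$ ($F\geq 1$), $\Psi\in\mathbb{R}^{n\times F}$, $\beta\in[0,1]$, and $e$ is the all-ones vector. Ellipsoidal set: $\mathcal{Q}_E=\{q\in\mathbb{R}^n: q=q^0+\Sigma^{1/2}\xi\text{ for some }\xi\in\mathbb{R}^n\text{ with }\xi^\top\xi\le1\}$, where $q^0\in\mathbb{R}^n_+$, $\Sigma$ is a symmetric positive semidefinite $n\times n$ matrix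 and $\Sigma^{1/2}$ is its symmetric positive semidefinite square root. Cardinality-constrained set: $\mathcal{Q}_G=\{q\in[q^0,q^0+\hat q]: q=q^0+(\hat q\circ\xi)\text{ for some }\xi\in\Xi_G\}$ with $\Xi_G=\{\xi\in[0,1]^n:e^\top\xi\le\Gamma\}$, where $q^0,\hat q\in\mathbb{R}^n_+$, $\Gamma\in[0,n]$, and $\circ$ is the componentwise product. Discrete set: $\mathcal{Q}_D=\mathrm{conv}\{q^{(j)}:j=1,\dots,D\}$, where $D\in\mathbb{N}$ ($D\ge1$) and $q^{(1)},\dots,q^{(D)}\in\mathbb{R}^n_+$ are given distinct points. *)

(* Defs.v *)
From HB Require Import structures.
From mathcomp Require Import all_boot all_order all_algebra.
From mathcomp Require Import all_classical all_reals all_analysis.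

Set Implicit Arguments.
Unset Strict Implicit.
Unset Printing Implicit Defensive.

Import Order.TTheory GRing.Theory Num.Theory.
Import numFieldNormedType.Exports.

Local Open Scope classical_set_scope.
Local Open Scope ring_scope.

Definition is_max (R : realType) (A : set R) (m : R) : Prop :=
  A m /\ ubound A m.

Definition load (R : realType) (n : nat) (S : {set 'I_n}) (q : 'cV[R]_n) : R :=
  \sum_(i in S) q i 0.

Definition is_worst_case_load (R : realType) (n : nat) (S : {set 'I_n})
    (Q : set 'cV[R]_n) (m : R) : Prop :=
  is_max [set load S q | q in Q] m.

Definition lecv (R : realType) (n : nat) (u v : 'cV[R]_n) : Prop :=
  forall i, u i 0 <= v i 0.

Definition box (R : realType) (n : nat) (u v : 'cV[R]_n) : set 'cV[R]_n :=
  [set q | lecv u q /\ lecv q v].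

Definition uncertainty_set (R : realType) (n : nat) (Q : set 'cV[R]_n) : Prop :=
  [/\ Q !=set0, closed Q, bounded_set Q & forall q, Q q -> lecv 0 q].

Definition budget_set (R : realType) (n L : nat) (qlo qhi : 'cV[R]_n)
    (B : 'I_L -> {set 'I_n}) (b : 'I_L -> R) : set 'cV[R]_n :=
  [set q | box qlo qhi q /\ forall l, \sum_(i in B l) q i 0 <= b l].

Definition Xi_F (R : realType) (F : nat) (beta : R) : set 'cV[R]_F :=
  [set xi | box (const_mx (-1)) (const_mx 1) xi /\
            `|\sum_f xi f 0| <= beta * F%:R].

Definition factor_set (R : realType) (n F : nat) (q0 : 'cV[R]_n)
    (Psi : 'M[R]_(n, F)) (beta : R) : set 'cV[R]_n :=
  [set q | exists2 xi, Xi_F beta xi & q = q0 + Psi *m xi].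

Definition psdmx (R : realType) (n : nat) (A : 'M[R]_n) : Prop :=
  A^T = A /\ forall x : 'cV[R]_n, 0 <= (x^T *m A *m x) 0 0.

Definition is_psd_sqrt (R : realType) (n : nat) (Sigma W : 'M[R]_n) : Prop :=
  psdmx W /\ W *m W = Sigma.

(* [W] is the symmetric positive semidefinite square root Sigma^(1/2). *)
Definition ellipsoid_set (R : realType) (n : nat) (q0 : 'cV[R]_n)
    (W : 'M[R]_n) : set 'cV[R]_n :=
  [set q | exists2 xi : 'cV[R]_n, (xi^T *m xi) 0 0 <= 1 & q = q0 + W *m xi].

(* The library norm on matrices is the max norm, not the Euclidean one. *)
Definition norm2 (R : realType) (n : nat) (v : 'cV[R]_n) : R :=
  Num.sqrt (\sum_i v i 0 ^+ 2).

Definition Xi_G (R : realType) (n : nat) (Gamma : R) : set 'cV[R]_n :=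
  [set xi | box 0 (const_mx 1) xi /\ \sum_i xi i 0 <= Gamma].

Definition cardinality_set (R : realType) (n : nat) (q0 qhat : 'cV[R]_n)
    (Gamma : R) : set 'cV[R]_n :=
  [set q | box q0 (q0 + qhat) q /\
           exists2 xi, Xi_G Gamma xi & q = q0 + map2_mx *%R qhat xi].

Definition conv_hull (R : realType) (n D : nat) (p : 'I_D -> 'cV[R]_n) :
    set 'cV[R]_n :=
  [set q | exists w : 'I_D -> R,
    [/\ forall j, 0 <= w j, \sum_j w j = 1 & q = \sum_j w j *: p j]].

(* [s] lists the elements of [A] by nonincreasing value of [c], each once.
   Listings are 0-based: the k-th element (k >= 1) has index k.-1. *)
Definition nonincreasing_listing (R : realType) (T : finType) (A : {set T})
    (c : T -> R) (s : seq T) : Prop :=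
  perm_eq s (enum A) /\ sorted >=%R [seq c x | x <- s].

(* Main.v *)
Require Import Defs.
From HB Require Import structures.
From mathcomp Require Import all_boot all_order all_algebra.
From mathcomp Require Import all_classical all_reals all_analysis.
From mathcomp Require Import ring lra.

Set Implicit Arguments.
Unset Strict Implicit.
Unset Printing Implicit Defensive.

Import Order.TTheory GRing.Theory Num.Theory.
Import numFieldNormedType.Exports.

Local Open Scope ring_scope.

(* In each case a feasible point attains an upper bound valid on the whole set.
   For the budget set, disjointness of the B_l decouples the constraints.  For
   the factor model, xi |-> c^T xi is bounded by phi(lam) for every multiplier
   lam of the constraint |e^T xi| <= beta F; the vector that is 1 on the
   largest c_j, -1 on the smallest ones and fractional at one threshold index m
   satisfies complementary slackness with lam = c_m, and m is chosen so that
   e^T xi = beta F (index l+) or - beta F (index l-), which works if c_m has the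
   corresponding sign; otherwise xi = sign(c) is feasible and lam = 0.  The
   cardinality set uses the same threshold argument, the ellipsoid the
   Cauchy-Schwarz inequality, and a linear form on a polytope is maximised at one
   of the points spanning it. *)

(** * Sums and monotonicity along a sorted listing *)

Section Listing.
Variables (R : realType) (T : finType) (A : {set T}) (c : T -> R) (s : seq T).
Hypothesis lst : nonincreasing_listing A c s.

Lemma listing_mem i : (i \in s) = (i \in A).
Proof. by rewrite (perm_mem lst.1) mem_enum. Qed.

Lemma size_listing : size s = #|A|.
Proof. by rewrite (perm_size lst.1) -cardE. Qed.

Lemma nth_listing_index i : i \in A -> nth 0 [seq c j | j <- s] (index i s) = c i.
Proof.
by rewrite -listing_mem => si; rewrite (nth_map i) ?index_mem// nth_index.
Qed.

(** [G] receives both rank and value, so the same reindexing serves for the entry sum of a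
    rank-defined vector and for its product with [c]. *)
Lemma sum_listing (G : nat -> R -> R) :
  \sum_(i in A) G (index i s) (c i) =
  \sum_(l < #|A|) G l (nth 0 [seq c j | j <- s] l).
Proof.
have us : uniq s by rewrite (perm_uniq lst.1) enum_uniq.
rewrite -big_enum -(perm_big _ lst.1) /= -size_listing.
case: s us => [|x s'] us; first by rewrite big_nil big_ord0.
rewrite (big_nth x) big_mkord; apply: eq_bigr => l _.
by rewrite index_uniq// (nth_map x).
Qed.

Lemma listing_anti l m : (l <= m)%N -> (m < #|A|)%N ->
  nth 0 [seq c j | j <- s] m <= nth 0 [seq c j | j <- s] l.
Proof.
rewrite -size_listing => lm ms.
have tr : transitive (>=%R : rel R) by move=> y x z /= xy yz; apply: le_trans xy.
have rf : reflexive (>=%R : rel R) by move=> x /=.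
apply: (sorted_leq_nth tr rf 0 lst.2) => //=; rewrite unfold_in /= size_map //.
exact: leq_ltn_trans ms.
Qed.

End Listing.

(** * Threshold vectors, as functions of the 0-based rank *)

Definition step (R : realType) (hi mid lo : R) (m l : nat) : R :=
  if (l < m)%N then hi else if l == m then mid else lo.

Section Step.
Variables (R : realType) (hi mid lo : R) (m : nat).

Lemma step_itv l : lo <= mid <= hi -> lo <= step hi mid lo m l <= hi.
Proof.
move=> /andP[lm mh]; rewrite /step; case: ifP => _; last case: ifP => _;
by rewrite ?lexx ?lm ?mh ?(le_trans lm mh).
Qed.

Lemma sum_step N : (m < N)%N ->
  \sum_(l < N) step hi mid lo m l = m%:R * hi + mid + (N%:R - m.+1%:R) * lo.
Proof.
move=> mN; rewrite -(big_mkord xpredT (step hi mid lo m)).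
rewrite (big_cat_nat (leq0n m) (ltnW mN)) /= [X in _ + X]big_ltn//.
have -> : step hi mid lo m m = mid by rewrite /step ltnn eqxx.
rewrite (@eq_big_nat _ _ _ 0 m _ (fun=> hi)); last first.
  by move=> l /andP[_ lm]; rewrite /step lm.
rewrite (@eq_big_nat _ _ _ m.+1 N _ (fun=> lo)); last first.
  by move=> l /andP[ml _]; rewrite /step ltnNge ltnW//= gtn_eqF.
by rewrite !sumr_const_nat subn0 -natrB// !mulr_natl addrA.
Qed.

End Step.

(** Covers listings too short to reach rank [m], where the fractional term disappears. *)
Lemma sum_mul_step (R : realType) (h : nat -> R) (t : R) (m N : nat) :
  \sum_(l < N) h l * step 1 t 0 m l =
  \sum_(l < minn N m) h l + (if (m < N)%N then t * h m else 0).
Proof.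
elim: N => [|N IH]; first by rewrite min0n !big_ord0 addr0.
rewrite big_ord_recr IH /= /step; case: (ltngtP N m) => [Nm|mN|->].
- rewrite (minn_idPl Nm) big_ord_recr /=.
  by rewrite ltnS leqNgt Nm/=; ring.
- rewrite (minn_idPr (leqW (ltnW mN))) ltnS (ltnW mN).
  by ring.
- by rewrite (minn_idPr (leqnSn m)) ltnSn; ring.
Qed.

Lemma absz_ceil_itv (R : realType) (x : R) : 0 <= x ->
  (`|Num.ceil x|%N)%:R - 1 < x <= (`|Num.ceil x|%N)%:R.
Proof.
move=> x0; rewrite natr_absz ger0_norm; last first.
  by rewrite ceil_ge0 (lt_le_trans _ x0)// ltrN10.
by have := ceil_itv x; rewrite intrB.
Qed.

(** * Factor model: Lagrangian bound and threshold vectors *)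

Section Factor.
Variables (R : realType) (F : nat).
Implicit Types (c xi : 'I_F -> R).

Lemma index_listing_ord c (f : seq 'I_F) (j : 'I_F) :
  nonincreasing_listing [set: 'I_F]%SET c f -> (index j f < F)%N.
Proof.
move=> lst; have := size_listing lst; rewrite cardsT card_ord => sz.
by rewrite -[X in (_ < X)%N]sz index_mem (listing_mem lst) inE.
Qed.

(** Split [c] as [(c - lam) + lam]: the first part is bounded entrywise by [|xi j| <= 1], the second
    by the bound on the entry sum. *)
Lemma factor_weak_duality c xi (b lam : R) :
  (forall j, -1 <= xi j <= 1) -> `|\sum_j xi j| <= b ->
  \sum_j c j * xi j <= \sum_j `|c j - lam| + b * `|lam|.
Proof.
move=> xi1 sxi.
have -> : \sum_j c j * xi j = \sum_j (c j - lam) * xi j + lam * \sum_j xi j.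
  by rewrite mulr_sumr -big_split/=; apply: eq_bigr => j _; ring.
apply: lerD.
  apply: ler_sum => j _; apply: le_trans (ler_norm _) _.
  by rewrite normrM ler_piMr// ler_norml.
by apply: le_trans (ler_norm _) _; rewrite normrM mulrC ler_wpM2r.
Qed.

(* Complementary slackness: the step vector saturates every [`|c j - lam|]. *)
Lemma factor_step_value c (f : seq 'I_F) (t : R) (m : nat) :
  nonincreasing_listing [set: 'I_F]%SET c f -> (m < F)%N ->
  let lam := nth 0 [seq c j | j <- f] m in
  \sum_j c j * step 1 t (-1) m (index j f) =
  \sum_j `|c j - lam| + lam * \sum_j step 1 t (-1) m (index j f).
Proof.
move=> lst mF lam; rewrite mulr_sumr -big_split/=; apply: eq_bigr => j _.
have cj : c j = nth 0 [seq c j | j <- f] (index j f).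
  by rewrite (nth_listing_index lst) ?inE.
have jF : (index j f < F)%N by exact: (index_listing_ord j lst).
suff -> : `|c j - lam| = (c j - lam) * step 1 t (-1) m (index j f) by ring.
rewrite /step; case: ltngtP => [jm|mj|jm].
- rewrite mulr1 ger0_norm// subr_ge0 cj.
  by apply: (listing_anti lst (ltnW jm)); rewrite cardsT card_ord.
- rewrite mulrN1 ler0_norm// subr_le0 cj.
  by apply: (listing_anti lst (ltnW mj)); rewrite cardsT card_ord.
- by rewrite cj jm subrr normr0 mul0r.
Qed.

(** There are [m] entries 1, one entry [t] and [F - m - 1] entries -1. *)
Lemma sum_factor_step c (f : seq 'I_F) (t : R) (m : nat) :
  nonincreasing_listing [set: 'I_F]%SET c f -> (m < F)%N ->
  \sum_j step 1 t (-1) m (index j f) = (m.*2.+1)%:R + t - F%:R.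
Proof.
move=> lst mF.
have := sum_listing lst (fun l _ => step 1 t (-1) m l).
rewrite cardsT card_ord sum_step// => e.
transitivity (\sum_(i in [set: 'I_F]) step 1 t (-1) m (index i f)).
  by apply: eq_bigl => j; rewrite inE.
by rewrite e -addnn -[in RHS]addn1 !natrD -(addn1 m) natrD; ring.
Qed.

End Factor.

Lemma load_factor (R : realType) (n F : nat) (S : {set 'I_n}) (q0 : 'cV[R]_n)
    (Psi : 'M[R]_(n, F)) (xi : 'cV[R]_F) :
  load S (q0 + Psi *m xi) =
  \sum_(i in S) q0 i 0 + \sum_j (\sum_(i in S) Psi i j) * xi j 0.
Proof.
rewrite /load; under eq_bigr do rewrite !mxE.
rewrite big_split/= exchange_big/=; congr (_ + _).
by apply: eq_bigr => j _; rewrite mulr_suml.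
Qed.

(** * Budget set *)

Lemma budget_worst_case (R : realType) (n : nat) (S : {set 'I_n})
    (L : nat) (qlo qhi : 'cV[R]_n) (B : 'I_L -> {set 'I_n}) (b : 'I_L -> R) :
  lecv qlo qhi ->
  (forall l, \sum_(i in B l) qlo i 0 <= b l) ->
  (forall l m, l != m -> [disjoint B l & B m]) ->
  is_worst_case_load S (budget_set qlo qhi B b)
    (\sum_(i in S) qhi i 0 -
     \sum_(l < L) Num.max 0
       (\sum_(i in S :&: B l) (qhi i 0 - qlo i 0) -
        (b l - \sum_(i in B l) qlo i 0))).
Proof.
move=> lohi loB disjB.
pose d i := qhi i 0 - qlo i 0.
have d0 i : 0 <= d i by rewrite subr_ge0.
pose D l := \sum_(i in S :&: B l) d i.
have D0 l : 0 <= D l by apply: sumr_ge0.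
pose s l := b l - \sum_(i in B l) qlo i 0.
have s0 l : 0 <= s l by rewrite subr_ge0.
have split_sum (h : 'I_n -> R) l : \sum_(i in B l) h i =
    \sum_(i in S :&: B l) h i + \sum_(i in B l :\: S) h i.
  by rewrite (big_setID S)/= finset.setIC.
have exch (h : 'I_n -> 'I_L -> R) :
    \sum_(i in S) \sum_(l | i \in B l) h i l =
    \sum_l \sum_(i in S :&: B l) h i l.
  rewrite (exchange_big_dep xpredT)//=; apply: eq_bigr => l _.
  by apply: eq_bigl => i; rewrite inE.
(* Disjointness: a customer lies in at most one budget, so this sum has a single term. *)
have in_one i l (h : 'I_L -> R) : i \in B l -> \sum_(k | i \in B k) h k = h l.
  move=> il; rewrite (big_pred1 l)// => k /=; apply/idP/eqP => [ik|->//].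
  apply/eqP/negPn/negP => /disjB.
  rewrite disjoint_subset => /fintype.subsetP/(_ i ik).
  by rewrite inE il.
split; last first.
  (* The bound becomes: the total drop from [qhi] to [q] on [S] is at least the sum of the
     maxima. *)
  move=> _ [q [[lo hi] qB] <-]; rewrite /load lerBrDr -lerBrDl -sumrB.
  apply: (@le_trans _ _ (\sum_l \sum_(i in S :&: B l) (qhi i 0 - q i 0))).
    apply: ler_sum => l _; rewrite ge_max; apply/andP; split.
      by apply: sumr_ge0 => i _; rewrite subr_ge0.
    (* Unserved customers of [B l] consume at least their [qlo], which limits what is left for the
       served ones. *)
    have := qB l; rewrite !split_sum !sumrB.
    have : \sum_(i in B l :\: S) qlo i 0 <= \sum_(i in B l :\: S) q i 0.
      by apply: ler_sum => i _.
    lra.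
  rewrite -exch; apply: ler_sum => i _.
  have [[l il]|none] := pselect (exists l, i \in B l); first by rewrite (in_one i l).
  by rewrite big_pred0 ?subr_ge0// => l; apply/negP => il; apply: none; exists l.
(* Within each [B l], move all served customers by the same fraction [u l] from
   [qhi] towards [qlo]; division by [D l = 0] harmlessly gives [u l = 0]. *)
pose u l := Num.max 0 (D l - s l) / D l.
have uD l : u l * D l = Num.max 0 (D l - s l).
  have [Dl|Dl] := eqVneq (D l) 0; last by rewrite /u divfK.
  by rewrite Dl mulr0 max_l// sub0r oppr_le0.
have u0 l : 0 <= u l by rewrite divr_ge0// le_max lexx.
have u1 l : u l <= 1.
  have [Dl|Dl] := eqVneq (D l) 0; first by rewrite /u Dl invr0 mulr0.
  by rewrite ler_pdivrMr ?lt0r ?Dl ?D0 // mul1r ge_max D0 lerBlDr lerDl s0.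
(* [v i] is [u l] for the unique budget containing [i], and 0 if there is none. *)
pose v i := \sum_(l | i \in B l) u l.
have v0 i : 0 <= v i by apply: sumr_ge0.
have v1 i : v i <= 1.
  have [[l il]|none] := pselect (exists l, i \in B l); first by
    rewrite /v (in_one i l).
  by rewrite /v big_pred0// => l; apply/negP => il; apply: none; exists l.
(* Unserved customers stay at [qlo], leaving as much budget as possible to those in [S]. *)
pose q : 'cV[R]_n := \col_i (if i \in S then qhi i 0 - v i * d i else qlo i 0).
have qS l : \sum_(i in S :&: B l) q i 0 =
    \sum_(i in S :&: B l) qhi i 0 - u l * D l.
  rewrite mulr_sumr -sumrB; apply: eq_bigr => i; rewrite inE => /andP[iS il].
  by rewrite mxE iS /v (in_one i l).
exists q.
  split; first (split=> i; rewrite mxE; case: ifP => _ //).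
  - have : v i * d i <= d i by rewrite ler_piMl.
    by rewrite /d; lra.
  - by rewrite gerBl mulr_ge0.
  move=> l; rewrite split_sum qS uD.
  have -> : \sum_(i in B l :\: S) q i 0 = \sum_(i in B l :\: S) qlo i 0.
    by apply: eq_bigr => i; rewrite inE mxE => /andP[/negbTE ->].
  have : D l - s l <= Num.max 0 (D l - s l) by rewrite le_max lexx orbT.
  rewrite {1}/D /s /d sumrB split_sum; lra.
rewrite /load.
transitivity (\sum_(i in S) (qhi i 0 - v i * d i)).
  by apply: eq_bigr => i iS; rewrite mxE iS.
rewrite sumrB; congr (_ - _).
under eq_bigr do rewrite mulr_suml.
by rewrite exch; apply: eq_bigr => l _; rewrite -mulr_sumr uD.
Qed.

(** * Factor model: attainment of the dual bound *)

Lemma factor_worst_case (R : realType) (n : nat) (S : {set 'I_n}) (F : nat)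
    (q0 : 'cV[R]_n) (Psi : 'M[R]_(n, F)) (beta : R) (f : seq 'I_F) :
  (1 <= F)%N -> 0 <= beta <= 1 ->
  let c (j : 'I_F) := \sum_(i in S) Psi i j in
  nonincreasing_listing [set: 'I_F]%SET c f ->
  let lplus := `|Num.ceil ((1 + beta) * F%:R / 2)|%N in
  let lminus := maxn 1 `|Num.ceil ((1 - beta) * F%:R / 2)|%N in
  let phi (lam : R) := \sum_(j < F) `|c j - lam| + beta * F%:R * `|lam| in
  is_worst_case_load S (factor_set q0 Psi beta)
    (\sum_(i in S) q0 i 0 +
     Num.min (phi 0)
       (Num.min (phi (nth 0 [seq c j | j <- f] lplus.-1))
                (phi (nth 0 [seq c j | j <- f] lminus.-1)))).
Proof.
move=> F1 /andP[beta0 beta1] c lst lplus lminus phi.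
set cp := nth 0 _ lplus.-1; set cm := nth 0 _ lminus.-1.
have FR : 1 <= F%:R :> R by rewrite ler1n.
have bF0 : 0 <= beta * F%:R by nra.
have bF1 : beta * F%:R <= F%:R by nra.
have /andP[lp1 lp2] : lplus%:R - 1 < (1 + beta) * F%:R / 2 <= lplus%:R.
  by apply: absz_ceil_itv; nra.
have lp0 : (0 < lplus)%N by rewrite -(ltr_nat R) mulr0n; nra.
have lpF : (lplus.-1 < F)%N.
  by rewrite prednK// -ltnS -(ltr_nat R) -(addn1 F) natrD; nra.
have lm0 : (0 < lminus)%N by rewrite leq_max.
(* The left inequality is weak: for [beta = 1] the ceiling is 0, [lminus] is raised to 1, and both
   sides are 0. *)
have /andP[lm1 lm2] : 2 * lminus%:R - 2 <= (1 - beta) * F%:R <= 2 * lminus%:R.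
  have /andP[] : (`|Num.ceil ((1 - beta) * F%:R / 2)|%N)%:R - 1 <
    (1 - beta) * F%:R / 2 <= (`|Num.ceil ((1 - beta) * F%:R / 2)|%N)%:R.
    by apply: absz_ceil_itv; nra.
  rewrite /lminus; case: (ltnP 1 `|Num.ceil ((1 - beta) * F%:R / 2)|%N) => h.
    by move=> *; apply/andP; split; lra.
  have : (`|Num.ceil ((1 - beta) * F%:R / 2)|%N)%:R <= 1%:R :> R.
    by rewrite ler_nat.
  by move=> *; apply/andP; split; nra.
have lmF : (lminus.-1 < F)%N.
  by rewrite prednK// -ltnS -(ltr_nat R) -(addn1 F) natrD; nra.
have weak lam xi : Xi_F beta xi -> \sum_j c j * xi j 0 <= phi lam.
  move=> [[lo hi] sxi]; apply: factor_weak_duality => // j.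
  by have := lo j; have := hi j; rewrite !mxE => -> ->.
set V := Num.min _ _.
have weakV xi : Xi_F beta xi -> \sum_j c j * xi j 0 <= V.
  by move=> h; rewrite /V !le_min !weak.
(* By weak duality the value of [xi] is at most [V], while [V <= phi lam]; a value equal to
   [phi lam] therefore equals [V]. *)
suff [xi Xxi [lam lamV xiV]] : exists2 xi, Xi_F beta xi &
    exists2 lam, V <= phi lam & \sum_j c j * xi j 0 = phi lam.
  split; last first.
    by move=> _ [q [x Xx ->] <-]; rewrite load_factor lerD2l weakV.
  exists (q0 + Psi *m xi); first by exists xi.
  rewrite load_factor; congr (_ + _); apply/eqP.
  by rewrite eq_le weakV// xiV lamV.
have col_sum (h : 'I_F -> R) : (forall j, -1 <= h j <= 1) ->
    `|\sum_j h j| <= beta * F%:R -> Xi_F beta (\col_j h j).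
  move=> h1 hs; split; last by under eq_bigr do rewrite mxE.
  by split=> j; rewrite !mxE; have /andP[] := h1 j.
have dbl m : (0 < m)%N -> (m.-1.*2.+1)%:R = 2 * m%:R - 1 :> R.
  case: m => // m _ /=; rewrite -addnn -addn1 !natrD -(addn1 m) natrD; ring.
have [cp0|cp0] := leP 0 cp.
  (* [t] solves [2 * lplus - 1 + t - F = beta * F]; the ceiling bounds put it in [-1, 1]. As
     [cp >= 0], the multiplier term is then [beta * F * |cp|]. *)
  pose t := beta * F%:R + F%:R - (2 * lplus%:R - 1).
  have t1 : -1 <= t <= 1 by rewrite /t; apply/andP; split; lra.
  have ss : \sum_j step 1 t (-1) lplus.-1 (index j f) = beta * F%:R.
    by rewrite (sum_factor_step t lst lpF) dbl// /t; ring.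
  exists (\col_j step 1 t (-1) lplus.-1 (index j f)).
    by apply: col_sum; [move=> j; exact: step_itv|rewrite ss ger0_norm].
  exists cp; first by rewrite /V !ge_min lexx !orbT.
  under eq_bigr do rewrite mxE.
  by rewrite (factor_step_value t lst lpF) ss mulrC /phi (ger0_norm cp0).
have [cm0|cm0] := leP cm 0.
  (* Mirror case: the entry sum is [- (beta * F)], and [cm <= 0] restores the sign. *)
  pose t := F%:R - beta * F%:R - (2 * lminus%:R - 1).
  have t1 : -1 <= t <= 1 by rewrite /t; apply/andP; split; lra.
  have ss : \sum_j step 1 t (-1) lminus.-1 (index j f) = - (beta * F%:R).
    by rewrite (sum_factor_step t lst lmF) dbl// /t; ring.
  exists (\col_j step 1 t (-1) lminus.-1 (index j f)).
    by apply: col_sum; [move=> j; exact: step_itv|rewrite ss normrN ger0_norm].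
  exists cm; first by rewrite /V !ge_min lexx !orbT.
  under eq_bigr do rewrite mxE.
  rewrite (factor_step_value t lst lmF) ss /phi (ler0_norm cm0) -/cm; ring.
(* Now [cp < 0 < cm]: the sign vector attains [phi 0], and only its feasibility is at stake. *)
pose sg (j : 'I_F) : R := if 0 <= c j then 1 else -1.
exists (\col_j sg j); last first.
  exists 0; first by rewrite /V !ge_min lexx.
  rewrite /phi normr0 mulr0 addr0; apply: eq_bigr => j _.
  rewrite mxE subr0 /sg; case: (leP 0 (c j)) => h.
    by rewrite ger0_norm// mulr1.
  by rewrite ltr0_norm// mulrN1.
apply: col_sum => [j|]; first by rewrite /sg; case: ifP => _; lra.
have idx j : (index j f < F)%N by exact: (index_listing_ord j lst).
have cT : #|[set: 'I_F]| = F by rewrite cardsT card_ord.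
have cE j : c j = nth 0 [seq c j | j <- f] (index j f).
  by rewrite (nth_listing_index lst) ?inE.
(* Comparing [sg] with the step vectors at [lplus] and [lminus] bounds its sum. *)
have up : \sum_j sg j <= \sum_j step 1 (-1) (-1) lplus.-1 (index j f).
  apply: ler_sum => j _; rewrite /sg /step; case: (leP 0 (c j)) => [cj|_].
    case: ltnP => // ij; suff : c j <= cp by lra.
    by rewrite cE; apply: (listing_anti lst ij); rewrite cT.
  by case: ifP => _; [lra|case: ifP].
have dn : \sum_j step 1 1 (-1) lminus.-1 (index j f) <= \sum_j sg j.
  apply: ler_sum => j _; rewrite /sg /step; case: (leP 0 (c j)) => [_|cj].
    by case: ifP => _ //; case: ifP => _; lra.
  have ij : (lminus.-1 < index j f)%N.
    rewrite ltnNge; apply/negP => ij; suff : cm <= c j by lra.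
    by rewrite cE; apply: (listing_anti lst ij); rewrite cT.
  by rewrite ltnNge (ltnW ij)/= gtn_eqF.
(* The step sums are [2 * lplus - 2 - F] and [2 * lminus - F]; by the ceiling bounds they are below
   [beta * F] and at least [- (beta * F)] respectively. *)
move: up dn; rewrite (sum_factor_step _ lst lpF) (sum_factor_step _ lst lmF).
rewrite !dbl// => up dn; rewrite ler_norml; apply/andP; split; lra.
Qed.

(** * Ellipsoid *)

Lemma norm2_sqr (R : realType) (n : nat) (v : 'cV[R]_n) :
  norm2 v ^+ 2 = \sum_i v i 0 ^+ 2.
Proof. by rewrite sqr_sqrtr// sumr_ge0// => i _; rewrite sqr_ge0. Qed.

(** With [N = norm2 v > 0], expand the nonnegative sum of [(N * x i - v i) ^+ 2] and divide by
    [2 * N]; if [N = 0], every entry of [v] vanishes. *)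
Lemma cauchy_schwarz_unit (R : realType) (n : nat) (v x : 'cV[R]_n) :
  \sum_i x i 0 ^+ 2 <= 1 -> \sum_i v i 0 * x i 0 <= norm2 v.
Proof.
move=> x1; have := norm2_sqr v; have : 0 <= norm2 v by exact: sqrtr_ge0.
set N := norm2 v; rewrite le0r => /orP[/eqP N0|N0] vN.
  rewrite N0 big1// => i _; move/eqP: vN.
  rewrite N0 expr0n eq_sym psumr_eq0/=; last by move=> j _; rewrite sqr_ge0.
  by move=> /allP/(_ i (mem_index_enum i))/=; rewrite sqrf_eq0 => /eqP ->;
    rewrite mul0r.
have : 0 <= \sum_i (N * x i 0 - v i 0) ^+ 2.
  by apply: sumr_ge0 => i _; rewrite sqr_ge0.
have -> : \sum_i (N * x i 0 - v i 0) ^+ 2 = N ^+ 2 * \sum_i x i 0 ^+ 2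
    - (2 * N) * \sum_i v i 0 * x i 0 + \sum_i v i 0 ^+ 2.
  rewrite !mulr_sumr -sumrB -big_split/=; apply: eq_bigr => i _; ring.
rewrite -vN => h; nra.
Qed.

Lemma ellipsoid_worst_case (R : realType) (n : nat) (S : {set 'I_n})
    (q0 : 'cV[R]_n) (W : 'M[R]_n) : W^T = W ->
  is_worst_case_load S (ellipsoid_set q0 W)
    (\sum_(i in S) q0 i 0 + norm2 (\sum_(i in S) col i W)).
Proof.
move=> symW; set v := \sum_(i in S) col i W.
have loadE x : load S (q0 + W *m x) = \sum_(i in S) q0 i 0 + \sum_j v j 0 * x j 0.
  rewrite load_factor; congr (_ + _); apply: eq_bigr => j _; congr (_ * _).
  (* The load sums rows of [W], the formula sums columns; symmetry identifies them. *)
  rewrite /v summxE; apply: eq_bigr => i _; by rewrite mxE -[in LHS]symW mxE.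
have sqE (x : 'cV[R]_n) : (x^T *m x) 0 0 = \sum_i x i 0 ^+ 2.
  by rewrite mxE; apply: eq_bigr => i _; rewrite mxE expr2.
split; last first.
  by move=> _ [q [x x1 ->] <-]; rewrite loadE lerD2l cauchy_schwarz_unit// -sqE.
have N2 := norm2_sqr v.
(* If [norm2 v = 0], the inverse is 0 and so is the chosen point. *)
exists (q0 + W *m ((norm2 v)^-1 *: v)).
  exists ((norm2 v)^-1 *: v) => //; rewrite sqE.
  under eq_bigr do rewrite mxE exprMn.
  rewrite -mulr_sumr -N2 -exprMn; have [->|N0] := eqVneq (norm2 v) 0.
    by rewrite mulr0 expr0n.
  by rewrite mulVf// expr1n.
rewrite loadE; congr (_ + _).
have -> : \sum_j v j 0 * ((norm2 v)^-1 *: v) j 0 =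
    (norm2 v)^-1 * \sum_j v j 0 ^+ 2.
  by rewrite mulr_sumr; apply: eq_bigr => j _; rewrite mxE; ring.
rewrite -N2; have [->|N0] := eqVneq (norm2 v) 0; first by rewrite expr0n mulr0.
by rewrite expr2 mulKf.
Qed.

(** * Cardinality-constrained set *)

Lemma cardinality_worst_case (R : realType) (n : nat) (S : {set 'I_n})
    (q0 qhat : 'cV[R]_n) (Gamma : R) (g : seq 'I_n) :
  lecv 0 qhat -> 0 <= Gamma ->
  nonincreasing_listing S (fun i => qhat i 0) g ->
  let k := `|Num.floor Gamma|%N in
  let qg := [seq qhat i 0 | i <- g] in
  let lam :=
    if (k.+1 <= #|S|)%N
    then (Gamma - (Num.floor Gamma)%:~R) * nth 0 qg k else 0 in
  is_worst_case_load S (cardinality_set q0 qhat Gamma)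
    (\sum_(i in S) q0 i 0 + \sum_(l < minn #|S| k) nth 0 qg l + lam).
Proof.
move=> hat0 G0 lst k qg lam.
have h0 i : 0 <= qhat i 0 by have := hat0 i; rewrite mxE.
have kE : (Num.floor Gamma)%:~R = k%:R :> R.
  by rewrite /k natr_absz ger0_norm// floor_ge0.
have /andP[kG Gk] : k%:R <= Gamma < k%:R + 1.
  by rewrite -kE; have := floor_itv Gamma; rewrite intrD.
pose t := Gamma - k%:R.
have t01 : 0 <= t <= 1 by rewrite /t; apply/andP; split; lra.
(* Greedy point: the [k] largest deviations in full, the fraction [t] of the next one, nothing
   outside [S]. *)
pose x i := if i \in S then step 1 t 0 k (index i g) else 0.
have x01 i : 0 <= x i <= 1.
  by rewrite /x; case: ifP => _; [exact: step_itv|rewrite lexx ler01].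
have loadE xi : load S (q0 + map2_mx *%R qhat xi) =
    \sum_(i in S) q0 i 0 + \sum_(i in S) qhat i 0 * xi i 0.
  by rewrite /load -big_split/=; apply: eq_bigr => i _; rewrite !mxE.
have boxE xi : box 0 (const_mx 1) xi ->
    box q0 (q0 + qhat) (q0 + map2_mx *%R qhat xi).
  move=> [lo hi]; split=> i;
    have := lo i; have := hi i; have := h0 i; rewrite !mxE; nra.
have sumx : \sum_(i in S) x i = \sum_(l < #|S|) step 1 t 0 k l.
  rewrite -(sum_listing lst (fun l _ => step 1 t 0 k l)).
  by apply: eq_bigr => i iS; rewrite /x iS.
(* The budget is exhausted as soon as a customer of rank [k] exists; otherwise it may be slack. *)
have sumxG : \sum_(i in S) x i <= Gamma /\
    ((k < #|S|)%N -> \sum_(i in S) x i = Gamma).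
  have [kS|Sk] := ltnP k #|S|.
    by rewrite sumx sum_step// /t; split=> [|_]; lra.
  split=> //; apply: le_trans kG; apply: (@le_trans _ _ #|S|%:R);
    last by rewrite ler_nat.
  rewrite -sumr_const; apply: ler_sum => i _; by have /andP[] := x01 i.
have value : \sum_(i in S) qhat i 0 * x i =
    \sum_(l < minn #|S| k) nth 0 qg l + lam.
  rewrite /lam kE -/t -(sum_mul_step (nth 0 qg)).
  rewrite -(sum_listing lst (fun l a => a * step 1 t 0 k l)).
  by apply: eq_bigr => i iS; rewrite /x iS.
rewrite -addrA -value; split.
  exists (q0 + map2_mx *%R qhat (\col_i x i)).
    have bx : box 0 (const_mx 1) (\col_i x i).
      by split=> i; rewrite !mxE; have /andP[] := x01 i.
    split; first exact: boxE.
    exists (\col_i x i) => //; split=> //.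
    under eq_bigr do rewrite mxE.
    rewrite (bigID (mem S))/= [X in _ + X]big1 ?addr0; last first.
      by move=> i /negbTE iS; rewrite /x iS.
    exact: sumxG.1.
  by rewrite loadE; congr (_ + _); apply: eq_bigr => i _; rewrite mxE.
move=> _ [q [_ [xi [[lo hi] sxi] ->]] <-]; rewrite loadE lerD2l.
(* Threshold argument: [x] maximises [sum (qhat - mu) * xi] termwise, where [mu]
   is the price of the budget ([mu = 0] when the budget is not binding). *)
pose mu := nth 0 qg k.
have xi0 i : 0 <= xi i 0 by have := lo i; rewrite mxE.
have xi1 i : xi i 0 <= 1 by have := hi i; rewrite mxE.
have sxiS : \sum_(i in S) xi i 0 <= Gamma.
  apply: le_trans sxi; rewrite [leRHS](bigID (mem S))/= lerDl.
  by apply: sumr_ge0.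
have mu0 : 0 <= mu.
  rewrite /mu; have [kg|gk] := ltnP k (size qg); last by rewrite nth_default.
  by have /mapP[i _ ->] := mem_nth 0 kg.
(* Complementary slackness: either [x] spends all of [Gamma], or rank [k] is out of range and the
   default of [nth] makes [mu] zero. *)
have muG : mu * \sum_(i in S) xi i 0 <= mu * \sum_(i in S) x i.
  have [kS|Sk] := ltnP k #|S|; first by rewrite sumxG.2// ler_wpM2l.
  by rewrite /mu nth_default ?mul0r// size_map (size_listing lst).
suff : \sum_(i in S) (qhat i 0 - mu) * xi i 0 <= \sum_(i in S) (qhat i 0 - mu) * x i.
  have E (y : 'I_n -> R) : \sum_(i in S) (qhat i 0 - mu) * y i =
      \sum_(i in S) qhat i 0 * y i - mu * \sum_(i in S) y i.
    by rewrite mulr_sumr -sumrB; apply: eq_bigr => i _; ring.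
  rewrite !E; lra.
apply: ler_sum => i iS; rewrite /x iS.
have ci : qhat i 0 = nth 0 qg (index i g) by rewrite (nth_listing_index lst) ?inE.
have iS' : (index i g < #|S|)%N.
  by rewrite -(size_listing lst) index_mem (listing_mem lst).
have := xi0 i; have := xi1 i; rewrite /step; case: ltngtP => [ik|ki|ik] y1 y0.
- suff : mu <= qhat i 0 by nra.
  have [kS|Sk] := ltnP k #|S|.
    by rewrite ci; exact: (listing_anti lst (ltnW ik)).
  by rewrite /mu nth_default ?size_map ?(size_listing lst).
- suff : qhat i 0 <= mu by nra.
  by rewrite ci; exact: (listing_anti lst (ltnW ki)).
- by rewrite ci ik subrr !mul0r.
Qed.

(** * Discrete set *)

Lemma discrete_worst_case (R : realType) (n : nat) (S : {set 'I_n}) (D : nat)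
    (hD : (1 <= D)%N) (p : 'I_D -> 'cV[R]_n) :
  is_worst_case_load S (conv_hull p)
    (\big[Num.max/load S (p (Ordinal hD))]_(d < D) load S (p d)).
Proof.
have loadE (w : 'I_D -> R) :
    load S (\sum_j w j *: p j) = \sum_j w j * load S (p j).
  rewrite /load; under eq_bigr do rewrite summxE.
  rewrite exchange_big/=; apply: eq_bigr => j _; rewrite mulr_sumr.
  by apply: eq_bigr => i _; rewrite mxE.
set M := \big[_/_]_(_ < _) _; split; last first.
  move=> _ [q [w [w0 w1 ->]] <-]; rewrite loadE -[M]mul1r -w1 mulr_suml.
  by apply: ler_sum => j _; apply: ler_wpM2l => //; exact: le_bigmax.
(* The seed of the maximum is itself the load of a point, so the maximum is attained; unit weight on
   that point gives the witness. *)
have [d ->] : exists d, M = load S (p d).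
  rewrite /M; elim/big_ind: _ => [|_ _ [d ->] [e ->]|d _];
    first by exists (Ordinal hD).
    by rewrite /Num.max; case: ifP => _; [exists e|exists d].
  by exists d.
exists (p d) => //; exists (fun j => (j == d)%:R); split => [j||].
- exact: ler0n.
- by rewrite (bigD1 d)//= eqxx big1 ?addr0// => j /negbTE ->.
- by rewrite (bigD1 d)//= eqxx scale1r big1 ?addr0// => j /negbTE ->; rewrite scale0r.
Qed.

Theorem proposition1 (R : realType) (n : nat) (route : seq 'I_n)
    (route_uniq : uniq route) (S : {set 'I_n}) (S_route : S =i route) :
  [/\ (forall (L : nat) (qlo qhi : 'cV[R]_n) (B : 'I_L -> {set 'I_n})
          (b : 'I_L -> R),
        lecv qlo qhi ->
        (forall l, 0 <= b l) ->
        (forall l, \sum_(i in B l) qlo i 0 <= b l) ->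
        (forall l m, l != m -> [disjoint B l & B m]) ->
        uncertainty_set (budget_set qlo qhi B b) ->
        is_worst_case_load S (budget_set qlo qhi B b)
          (\sum_(i in S) qhi i 0 -
           \sum_(l < L) Num.max 0
             (\sum_(i in S :&: B l) (qhi i 0 - qlo i 0) -
              (b l - \sum_(i in B l) qlo i 0)))),
      (forall (F : nat) (q0 : 'cV[R]_n) (Psi : 'M[R]_(n, F)) (beta : R)
          (f : seq 'I_F),
        lecv 0 q0 ->
        (1 <= F)%N ->
        0 <= beta <= 1 ->
        uncertainty_set (factor_set q0 Psi beta) ->
        let c (j : 'I_F) := \sum_(i in S) Psi i j in
        nonincreasing_listing [set: 'I_F]%SET c f ->
        let lplus := `|Num.ceil ((1 + beta) * F%:R / 2)|%N in
        let lminus := maxn 1 `|Num.ceil ((1 - beta) * F%:R / 2)|%N in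
        let phi (lam : R) :=
          \sum_(j < F) `|c j - lam| + beta * F%:R * `|lam| in
        is_worst_case_load S (factor_set q0 Psi beta)
          (\sum_(i in S) q0 i 0 +
           Num.min (phi 0)
             (Num.min (phi (nth 0 [seq c j | j <- f] lplus.-1))
                      (phi (nth 0 [seq c j | j <- f] lminus.-1))))),
      (forall (q0 : 'cV[R]_n) (Sigma W : 'M[R]_n),
        lecv 0 q0 ->
        psdmx Sigma ->
        is_psd_sqrt Sigma W ->
        uncertainty_set (ellipsoid_set q0 W) ->
        is_worst_case_load S (ellipsoid_set q0 W)
          (\sum_(i in S) q0 i 0 + norm2 (\sum_(i in S) col i W))),
      (forall (q0 qhat : 'cV[R]_n) (Gamma : R) (g : seq 'I_n),
        lecv 0 q0 ->
        lecv 0 qhat ->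
        0 <= Gamma <= n%:R ->
        uncertainty_set (cardinality_set q0 qhat Gamma) ->
        nonincreasing_listing S (fun i => qhat i 0) g ->
        let k := `|Num.floor Gamma|%N in
        let qg := [seq qhat i 0 | i <- g] in
        let lam :=
          if (k.+1 <= #|S|)%N
          then (Gamma - (Num.floor Gamma)%:~R) * nth 0 qg k else 0 in
        is_worst_case_load S (cardinality_set q0 qhat Gamma)
          (\sum_(i in S) q0 i 0 + \sum_(l < minn #|S| k) nth 0 qg l + lam)) &
      (forall (D : nat) (hD : (1 <= D)%N) (p : 'I_D -> 'cV[R]_n),
        (forall j, lecv 0 (p j)) ->
        injective p ->
        uncertainty_set (conv_hull p) ->
        is_worst_case_load S (conv_hull p)
          (\big[Num.max/load S (p (Ordinal hD))]_(d < D) load S (p d)))].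

Proof.
split.
- by move=> L qlo qhi B b lohi _ loB disjB _; exact: budget_worst_case.
- by move=> F q0 Psi beta f _ F1 beta01 _ c lst lplus lminus phi;
    exact: factor_worst_case.
- by move=> q0 Sigma W _ _ [[symW _] _] _; exact: ellipsoid_worst_case.
- move=> q0 qhat Gamma g _ hat0 /andP[Gamma0 _] _ lst k qg lam.
  exact: cardinality_worst_case.
- by move=> D hD p _ _ _; exact: discrete_worst_case.
Qed.
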